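(* Let $G$ be a bipartite graph with $n$ vertices, at least one edge, and maximum vertex degree $\Delta$. Then $$EE(G) \ge 2\cosh\sqrt{\Delta} + (n-2),$$ with equality if and only if $G\cong S_n$ or $G\cong S_{\Delta+1}\cup (n-\Delta-1)K_1$.
   Context: All graphs are finite, simple and undirected. For a graph $G$ with adjacency matrix $A(G)$ having eigenvalues $\lambda_1\ge\cdots\ge\lambda_n$, the Estrada index is $EE(G)=\sum_{i=1}^n e^{\lambda_i}$. $S_k=K_{1,k-1}$ denotes the star on $k$ vertices; $\cup$ denotes disjoint union and $rK_1$ denotes $r$ isolated vertices. *)

(* Defs.v *)
From HB Require Import structures.
From mathcomp Require Import all_boot all_order all_algebra.
From Stdlib Require Import Reals.
Set Implicit Arguments. Unset Strict Implicit. Unset Printing Implicit Defensive.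

Definition simple_graph (n : nat) (e : rel 'I_n) : Prop :=
  (forall i, e i i = false) /\ (forall i j, e i j = e j i).

Definition has_edge (n : nat) (e : rel 'I_n) : Prop := exists i j, e i j.

Definition bipartite (n : nat) (e : rel 'I_n) : Prop :=
  exists f : 'I_n -> bool, forall i j, e i j -> f i != f j.

Definition degree (n : nat) (e : rel 'I_n) (i : 'I_n) : nat := #|[set j | e i j]|.

Definition max_degree (n : nat) (e : rel 'I_n) : nat := (\max_(i < n) degree e i)%N.

Definition adj_mx (n : nat) (e : rel 'I_n) : 'M[int]_n :=
  \matrix_(i, j) (Posz (if e i j then 1%N else 0%N)).

Definition int_to_Z (z : int) : Z :=
  match z with
  | Posz k => Z.of_nat k
  | Negz k => (- Z.of_nat k.+1)%Z
  end.

Definition poly_evalR (p : {poly int}) (x : R) : R :=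
  foldr (fun c acc => (IZR (int_to_Z c) + x * acc)%R) 0%R (polyseq p).

Definition is_spectrum (n : nat) (e : rel 'I_n) (lam : list R) : Prop :=
  List.length lam = n /\
  forall x : R, poly_evalR (char_poly (adj_mx e)) x
                = List.fold_right Rmult 1%R (List.map (fun l => (x - l)%R) lam).

Definition estrada (lam : list R) : R :=
  List.fold_right Rplus 0%R (List.map exp lam).

(* G is isomorphic to S_k ∪ (n-k) K_1 (k >= 1): a centre c adjacent exactly to
   a set S of k-1 leaves, all other vertices isolated. *)
Definition star_plus_isolated (n : nat) (e : rel 'I_n) (k : nat) : Prop :=
  exists (c : 'I_n) (S : {set 'I_n}),
    c \notin S /\ #|S| = k.-1 /\
    forall i j, e i j = ((i == c) && (j \in S)) || ((j == c) && (i \in S)).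

(* Main.v *)
(** Let A be the adjacency matrix and p_k = tr A^k = sum_i lam_i^k, so that EE(G) = sum_k p_k / k!.
    A vertex c of maximum degree Delta spans a star whose adjacency matrix B satisfies 0 <= B <= A
    entrywise, hence tr B^k <= p_k for every k.  As B^3 = Delta B, tr B = 0 and tr B^2 = 2 Delta,
    the traces of the powers of B are the power sums of sqrt Delta, - sqrt Delta, 0, ..., 0, for
    which sum_k tr B^k / k! is the claimed bound.  In the equality case all terms of the two series
    agree; the terms k = 2 say that A and B have equally many nonzero entries, so A = B. *)

From HB Require Import structures.
From mathcomp Require Import all_boot all_order all_algebra.
From mathcomp Require Import complex Rstruct.
From Stdlib Require Import Factorial Reals Lra.
Require Import Defs.
Set Implicit Arguments. Unset Strict Implicit. Unset Printing Implicit Defensive.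
Import Order.TTheory GRing.Theory Num.Theory.
Local Open Scope ring_scope.

(** * Traces of matrix powers as power sums of eigenvalues *)

Lemma trig_mx_mul (R : pzSemiRingType) n (A B : 'M[R]_n) :
  is_trig_mx A -> is_trig_mx B ->
  is_trig_mx (A *m B) /\ forall i, (A *m B) i i = A i i * B i i.
Proof.
move=> /is_trig_mxP tA /is_trig_mxP tB; split=> [|i].
  apply/is_trig_mxP => i j lt_ij; rewrite mxE big1 // => k _.
  have [le_ki|lt_ik] := leqP k i; last by rewrite tA ?mul0r.
  by rewrite tB ?mulr0 // (leq_ltn_trans le_ki).
rewrite mxE (bigD1 i) //= big1 ?addr0 // => k.
rewrite neq_ltn => /orP[lt_ki|lt_ik]; first by rewrite tB ?mulr0.
by rewrite tA ?mul0r.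
Qed.

Lemma mxtrace_trig_exp (R : pzSemiRingType) n (A : 'M[R]_n) k :
  is_trig_mx A -> \tr (A ^+ k) = \sum_i A i i ^+ k.
Proof.
move=> tA.
have [_ dAk] : is_trig_mx (A ^+ k) /\ forall i, (A ^+ k) i i = A i i ^+ k.
  elim: k => [|k [tAk dAk]].
    split=> [|i]; first by rewrite expr0 scalar_mx_is_trig.
    by rewrite !expr0 mxE eqxx.
  have [tAS dAS] := trig_mx_mul tA tAk.
  by rewrite exprS; split=> // i; rewrite dAS dAk exprS.
by apply: eq_bigr => i _.
Qed.

(** Similarity is stated without an inverse, so the relation passes to powers by induction;
    cyclicity of the trace then cancels [P]. *)
Lemma mxtrace_exp_conj (R : comUnitRingType) n (P A T : 'M[R]_n) k :
  P \in unitmx -> P *m A = T *m P -> \tr (A ^+ k) = \tr (T ^+ k).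
Proof.
move=> uP PA; have PAk : P *m A ^+ k = T ^+ k *m P.
  elim: k => [|k IH]; first by rewrite !expr0 mulmx1 mul1mx.
  by rewrite !exprSr mulmxA IH -mulmxA PA mulmxA.
by rewrite -[A ^+ k](mulKmx uP) PAk mulmxA mxtrace_mulC mulmxA mulmxV // mul1mx.
Qed.

(** [P], lifted to constant polynomials, commutes with the scalar matrix of ['X] and so conjugates
    the characteristic matrices; determinants then commute. *)
Lemma char_poly_conj (R : comUnitRingType) n (P A T : 'M[R]_n) :
  P \in unitmx -> P *m A = T *m P -> char_poly A = char_poly T.
Proof.
move=> uP PA; pose Q := map_mx polyC P; pose Q' := map_mx polyC (invmx P).
have QQ' : Q *m Q' = 1%:M by rewrite -map_mxM mulmxV // map_mx1.
have QA : Q *m char_poly_mx A = char_poly_mx T *m Q.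
  by rewrite mulmxBr mulmxBl -!map_mxM PA scalar_mxC.
have dQ : \det Q * \det Q' = 1 by rewrite -det_mulmx QQ' det1.
rewrite /char_poly -[\det (char_poly_mx A)]mul1r -dQ mulrAC -det_mulmx QA.
by rewrite det_mulmx -mulrA dQ mulr1.
Qed.

(** Schur triangularization: the diagonal entries of the triangular form are the roots of the
    characteristic polynomial, so by unique factorization they are [s] up to order. *)
Lemma mxtrace_exp_closed (C : numClosedFieldType) n (A : 'M[C]_n) s k :
  char_poly A = \prod_(x <- s) ('X - x%:P) -> \tr (A ^+ k) = \sum_(x <- s) x ^+ k.
Proof.
case: n A => [|n] A chA.
  (* Triangularization below takes a matrix of positive size. At size 0 the degree forces [s] to be
     empty, and both sides vanish. *)
  have: size (char_poly A) = (size s).+1 by rewrite chA size_prod_XsubC.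
  rewrite size_char_poly => -[/esym/size0nil->].
  by rewrite big_nil /mxtrace big_ord0.
have [P /unitarymx_unit uP trigA] := Schur A isT.
have PA : P *m A = conjmx P A *m P by rewrite conjumx // mulmxKV.
rewrite (mxtrace_exp_conj k uP PA) mxtrace_trig_exp //.
have: perm_eq [seq (conjmx P A) i i | i <- enum 'I_n.+1] s.
  apply: prod_XsubC_eq; rewrite -chA (char_poly_conj uP PA) char_poly_trig //.
  by rewrite big_map big_enum.
by move/(perm_big _)<-; rewrite big_map big_enum.
Qed.

(** The embedding of [F] into its closure [F[i]] is injective and respects traces, powers and
    characteristic polynomials. *)
Lemma mxtrace_exp_real (F : rcfType) n (A : 'M[F]_n) s k :
  char_poly A = \prod_(x <- s) ('X - x%:P) -> \tr (A ^+ k) = \sum_(x <- s) x ^+ k.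
Proof.
move=> chA; pose f : {rmorphism F -> F[i]} := real_complex F.
apply: (fmorph_inj f); rewrite -trace_map_mx rmorph_sum.
have -> : map_mx f (A ^+ k) = map_mx f A ^+ k.
  by elim: k => [|k IH]; rewrite ?map_mx1 // !exprS map_mxM IH.
rewrite (mxtrace_exp_closed (s := map f s)).
  by rewrite big_map; apply: eq_bigr => x _; rewrite rmorphXn.
by rewrite -map_char_poly chA map_prod_XsubC big_map.
Qed.

(** * From pointwise factorization over the reals to power sums *)

Lemma horner_inj (F : numDomainType) (p q : {poly F}) :
  (forall x, p.[x] = q.[x]) -> p = q.
Proof.
move=> pq; apply/eqP; rewrite -subr_eq0; apply: contraT => nz.
(* The first [size (p - q)] naturals are distinct roots, too many for a nonzero polynomial. *)
have := @max_poly_roots _ _ [seq i%:R | i <- iota 0 (size (p - q))] nz.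
rewrite size_map size_iota ltnn => -> //.
  by apply/allP => x _; rewrite rootE hornerD hornerN pq subrr.
by rewrite map_inj_uniq ?iota_uniq // => i j /eqP; rewrite eqr_nat => /eqP.
Qed.

Lemma IZR_int_to_Z (z : int) : IZR (int_to_Z z) = z%:~R.
Proof.
case: z => k /=; first by rewrite -INR_IZR_INZ INRE.
by rewrite -[LHS]/(IZR (- Z.of_nat k.+1)) opp_IZR -INR_IZR_INZ INRE.
Qed.

Lemma poly_evalRE (p : {poly int}) x : poly_evalR p x = (map_poly intr p).[x].
Proof.
rewrite map_polyE horner_Poly /poly_evalR.
elim: (polyseq p) => //= c s ->.
by rewrite IZR_int_to_Z RplusE RmultE mulrC addrC.
Qed.

Lemma fold_Rmult (T : Type) (f : T -> R) s :
  List.fold_right Rmult 1%R (List.map f s) = \prod_(x <- s) f x.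
Proof. by elim: s => [|x s IH]; rewrite ?big_nil //= big_cons IH. Qed.

Definition power_sum (s : seq R) k : R := \sum_(x <- s) x ^+ k.

Definition adj_mxR n (e : rel 'I_n) : 'M[R]_n := \matrix_(i, j) (e i j)%:R.

(** [is_spectrum] equates values at every real point; [horner_inj] upgrades this to a factorization
    of the characteristic polynomial. *)
Lemma power_sum_spectrum n (e : rel 'I_n) s k :
  is_spectrum e s -> power_sum s k = \tr (adj_mxR e ^+ k).
Proof.
move=> [_ sE]; apply/esym/mxtrace_exp_real/horner_inj => x.
have -> : adj_mxR e = map_mx intr (adj_mx e).
  by apply/matrixP => i j; rewrite !mxE; case: (e i j).
rewrite -map_char_poly -poly_evalRE sE fold_Rmult horner_prod.
by apply: eq_bigr => y _; rewrite hornerXsubC.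
Qed.

(** * Powers of the adjacency matrix of a star *)

Definition star_rel n (c : 'I_n) (S : {set 'I_n}) : rel 'I_n :=
  fun i j => ((i == c) && (j \in S)) || ((j == c) && (i \in S)).

Lemma star_relC n (c : 'I_n) S i j : star_rel c S i j = star_rel c S j i.
Proof. exact: orbC. Qed.

(** With [x] the indicator of the centre and [v] that of the leaves, products of star matrices
    reduce to inner products of [x] and [v]. *)
Lemma adj_mxR_star n (c : 'I_n) (S : {set 'I_n}) (x := delta_mx c 0 : 'cV[R]_n)
    (v := \col_i (i \in S)%:R : 'cV[R]_n) :
  c \notin S -> adj_mxR (star_rel c S) = x *m v^T + v *m x^T.
Proof.
move=> /negbTE cS; apply/matrixP=> i j.
rewrite !mxE !big_ord1 !mxE !eqxx !andbT -!natrM -natrD; congr _%:R.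
rewrite /star_rel; case: eqP => [->|_]; case: eqP => [->|_]; rewrite ?cS //=.
- by case: (j \in S).
- by case: (i \in S).
by rewrite muln0.
Qed.

(** The vectors [x] and [v] are orthogonal with squared norms 1 and [#|S|], which fixes every
    product of the outer-product terms. *)
Lemma mxtrace_star n (c : 'I_n) (S : {set 'I_n}) (B := adj_mxR (star_rel c S)) :
  c \notin S -> [/\ \tr B = 0, \tr (B ^+ 2) = #|S|%:R *+ 2 & B ^+ 3 = #|S|%:R *: B].
Proof.
move=> cS; rewrite /B adj_mxR_star //.
set x := delta_mx c 0; set v := \col_i _.
have xx : x^T *m x = 1%:M.
  by rewrite trmx_delta mul_delta_mx; apply/matrixP => i j; rewrite !ord1 !mxE eqxx.
have xv : x^T *m v = 0.
  by rewrite trmx_delta -rowE; apply/matrixP => i j; rewrite !mxE (negbTE cS).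
have vx : v^T *m x = 0 by rewrite -[LHS]trmxK trmx_mul trmxK xv trmx0.
have vv : v^T *m v = #|S|%:R%:M.
  apply/matrixP => i j; rewrite !ord1 !mxE eqxx mulr1n -sum1_card natr_sum [RHS]big_mkcond /=.
  by apply: eq_bigr => k _; rewrite !mxE; case: (k \in S); rewrite ?mulr1 ?mulr0.
have B2 : (x *m v^T + v *m x^T) ^+ 2 = #|S|%:R *: (x *m x^T) + v *m v^T.
  rewrite expr2 -[_ * _]/(_ *m _) mulmxDl !mulmxDr -!mulmxA ![x^T *m (_ *m _)]mulmxA.
  rewrite ![v^T *m (_ *m _)]mulmxA xx xv vx vv !mul0mx !mulmx0 add0r addr0 mul1mx.
  by rewrite mul_scalar_mx scalemxAr.
split.
- by rewrite mxtraceD ![\tr (_ *m _^T)]mxtrace_mulC xv vx mxtrace0 addr0.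
- rewrite B2 mxtraceD mxtraceZ ![\tr (_ *m _^T)]mxtrace_mulC xx vv.
  by rewrite !mxtrace_scalar mulr1.
rewrite exprSr B2 -[_ * _]/(_ *m _) mulmxDl !mulmxDr -!scalemxAl -!mulmxA.
rewrite ![x^T *m (_ *m _)]mulmxA ![v^T *m (_ *m _)]mulmxA xx xv vx vv.
by rewrite !mul0mx !mulmx0 scaler0 add0r addr0 mul1mx mul_scalar_mx -scalemxAr scalerDr.
Qed.

(* The bound of the theorem is the Estrada index of this list; it has n entries only if n > 1,
   since n - 2 is truncated. *)
Definition star_spectrum n d : seq R :=
  [:: Num.sqrt d%:R, - Num.sqrt d%:R & nseq (n - 2) 0].

Lemma power_sum_star n (c : 'I_n) (S : {set 'I_n}) k :
  c \notin S -> (1 < n)%nat ->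
  \tr (adj_mxR (star_rel c S) ^+ k) = power_sum (star_spectrum n #|S|) k.
Proof.
move=> cS n_gt1; have [tr1 tr2 B3] := mxtrace_star cS.
set s := star_spectrum n _; have ss m : power_sum s m.+1 =
    Num.sqrt #|S|%:R ^+ m.+1 + (- Num.sqrt #|S|%:R) ^+ m.+1.
  rewrite /power_sum !big_cons big1_seq ?addr0 // => y /andP[_].
  by rewrite mem_nseq => /andP[_ /eqP->]; rewrite expr0n.
have sqr : Num.sqrt (#|S|%:R : R) ^+ 2 = #|S|%:R by rewrite sqr_sqrtr ?ler0n.
case: k => [|k].
  (* Only at exponent 0 do the zeros of the list count, as [0 ^+ 0 = 1]; both sides are then [n]. *)
  rewrite expr0 mxtrace1 /power_sum (eq_bigr (fun=> 1)) => [|y _]; last by rewrite expr0.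
  by rewrite big_const_seq count_predT iter_addr_0 /= size_nseq -addn2 addnC subnKC.
(* Both sides satisfy the recurrence [a (k + 3) = #|S| * a (k + 1)]: the traces by the cubic
   relation, the power sums because the two roots square to [#|S|]. Exponents 1 and 2 start it. *)
elim/ltn_ind: k => -[|[|k]] IH; first by rewrite !expr1 tr1 ss !expr1 subrr.
  by rewrite tr2 ss sqrrN sqr mulr2n.
rewrite -addn3 addnC exprD B3 -[_ * _]/(_ *m _) -scalemxAl -[_ *m _]/(_ * _) mxtraceZ -exprS IH // !ss.
by rewrite ![_ ^+ k.+3](exprD _ 2 k.+1) sqrrN sqr mulrDr.
Qed.

(** * Comparison of a graph with a subgraph *)

Lemma ler_exp_mx (F : numDomainType) n (A B : 'M[F]_n) k : (forall i j, 0 <= B i j <= A i j) ->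
  forall i j, 0 <= (B ^+ k) i j <= (A ^+ k) i j.
Proof.
move=> BA; elim: k => [|k IH] i j; first by rewrite !expr0 mxE ler0n lexx.
rewrite !exprS -![_ * _]/(_ *m _) !mxE; apply/andP; split.
  by apply: sumr_ge0 => l _; apply: mulr_ge0; [case/andP: (BA i l)|case/andP: (IH l j)].
by apply: ler_sum => l _; case/andP: (BA i l) => ? ?; case/andP: (IH l j) => ? ?; apply: ler_pM.
Qed.

Lemma mxtrace_adj_sqr n (e : rel 'I_n) : (forall i j, e i j = e j i) ->
  \tr (adj_mxR e ^+ 2) = \sum_i \sum_j (e i j)%:R.
Proof.
move=> eC; apply: eq_bigr => i _; rewrite expr2 mxE; apply: eq_bigr => j _.
by rewrite !mxE (eC j) -natrM mulnb andbb.
Qed.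

Section Subgraph.

Variables (n : nat) (e b : rel 'I_n).
Hypotheses (eC : forall i j, e i j = e j i) (bC : forall i j, b i j = b j i).
Hypothesis sub_be : forall i j, b i j -> e i j.

Let le_be i j : ((b i j)%:R <= (e i j)%:R :> R).
Proof. by rewrite ler_nat; case: (b i j) (@sub_be i j) => // ->. Qed.

Lemma ler_trace_subgraph k : \tr (adj_mxR b ^+ k) <= \tr (adj_mxR e ^+ k).
Proof.
apply: ler_sum => i _.
have le_mx i1 j1 : 0 <= adj_mxR b i1 j1 <= adj_mxR e i1 j1.
  by rewrite !mxE ler0n le_be.
by case/andP: (ler_exp_mx k le_mx i i).
Qed.

(** The traces of the squares count ordered adjacent pairs, so the nonnegative differences of the
    entries sum to zero and each vanishes. *)
Lemma eq_subgraph : \tr (adj_mxR b ^+ 2) = \tr (adj_mxR e ^+ 2) -> b =2 e.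
Proof.
rewrite !mxtrace_adj_sqr // !pair_bigA /= => eq_be i j.
have /eqP : \sum_(p : 'I_n * 'I_n) ((e p.1 p.2)%:R - (b p.1 p.2)%:R) = 0 :> R.
  by rewrite sumrB eq_be subrr.
rewrite psumr_eq0 => [/allP/(_ (i, j))|p _]; last by rewrite subr_ge0.
by rewrite mem_index_enum subr_eq0 eqr_nat => /(_ isT); case: (b i j); case: (e i j).
Qed.

End Subgraph.

(** * Maximum degree and stars *)

Lemma degree_eq_max n (e : rel 'I_n) : has_edge e -> exists c, degree e c = max_degree e.
Proof.
case=> i _; rewrite /max_degree.
have [|c ->] := @bigop.eq_bigmax _ (degree e); last by exists c.
by rewrite card_ord (leq_ltn_trans _ (ltn_ord i)).
Qed.

Lemma degree_star n (c : 'I_n) (S : {set 'I_n}) :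
  c \notin S -> degree (star_rel c S) c = #|S|.
Proof.
by move=> /negbTE cS; apply: eq_card => j; rewrite inE /star_rel eqxx cS andbF orbF.
Qed.

Lemma star_sub n (e : rel 'I_n) c : (forall i j, e i j = e j i) ->
  forall i j, star_rel c [set j | e c j] i j -> e i j.
Proof. by move=> eC i j; rewrite /star_rel !inE => /orP[] /andP[/eqP->] //; rewrite eC. Qed.

Lemma max_degree_le n (e : rel 'I_n) : (forall i, e i i = false) -> (max_degree e <= n.-1)%nat.
Proof.
move=> eI; apply/bigmax_leqP => i _; rewrite -[n in n.-1]card_ord -(cardsC1 i).
by apply/subset_leq_card/subsetP => j; rewrite !inE; apply: contraTneq => ->; rewrite eI.
Qed.

(** Merges the two equality cases: the centre of a spanning star has degree [n.-1], the largest
    possible, so [S_n] is an instance of the second form. *)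
Lemma star_plus_isolated_max_degree n (e : rel 'I_n) : (forall i, e i i = false) ->
  star_plus_isolated e n \/ star_plus_isolated e (max_degree e).+1 ->
  star_plus_isolated e (max_degree e).+1.
Proof.
move=> eI [[c [S [cS [Sn eE]]]]|//]; exists c, S; split=> //; split=> //.
apply/eqP; rewrite eqn_leq -{1}(degree_star cS) Sn max_degree_le // andbT.
have -> : degree (star_rel c S) c = degree e c by apply: eq_card => j; rewrite !inE eE.
exact: leq_bigmax.
Qed.

Lemma has_edge_gt1 n (e : rel 'I_n) : (forall i, e i i = false) -> has_edge e -> (1 < n)%nat.
Proof.
move=> eI [i [j eij]]; have ij : i != j by apply: contraTneq eij => ->; rewrite eI.
by have := max_card (mem [set i; j]); rewrite cards2 ij card_ord.
Qed.

(** * The Estrada index as a series of power sums *)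

Lemma power_sum_cons x s k : power_sum (x :: s) k = (x ^ k + power_sum s k)%R.
Proof. by rewrite /power_sum big_cons -RpowE. Qed.

(** Induction on the list adds the exponential series of its entries, so only finitely many
    convergent series are summed. *)
Lemma estrada_series s :
  infinite_sum (fun k => (power_sum s k / INR (fact k))%R) (estrada s).
Proof.
elim: s => [|x s IH].
  have cv0 : Un_cv (fun _ => 0%R) 0%R by move=> eps ?; exists 0%nat => m _; rewrite R_dist_eq.
  apply: (Un_cv_ext (fun _ => 0%R)) cv0 => m.
  by elim: m => [|m IHm] /=; rewrite -?IHm /power_sum big_nil /Rdiv Rmult_0_l ?Rplus_0_r.
(* [exp x] is defined as the witness in [exist_exp x], whose proof component is this convergence. *)
have expx : infinite_sum (fun k => (/ INR (fact k) * x ^ k)%R) (exp x) := proj2_sig (exist_exp x).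
apply: Un_cv_ext (CV_plus _ _ _ _ expx IH) => m; rewrite -plus_sum.
apply: sum_eq => k _; rewrite power_sum_cons /Rdiv; ring.
Qed.

Section PowerSumComparison.

Variables (s t : seq R).

Lemma estrada_ext : power_sum s =1 power_sum t -> estrada s = estrada t.
Proof.
move=> st; apply: uniqueness_sum (estrada_series s) _.
by apply: Un_cv_ext (estrada_series t) => m; apply: sum_eq => k _; rewrite st.
Qed.

Hypothesis le_st : forall k, power_sum s k <= power_sum t k.

(** The difference of the two series has nonnegative terms, so any single term is at most its sum.
    This yields both the inequality and its equality case. *)
Lemma estrada_gap k :
  ((power_sum t k - power_sum s k) / INR (fact k) <= estrada t - estrada s)%R.
Proof.
pose gap m := ((power_sum t m - power_sum s m) / INR (fact m))%R.
have gap_ge0 m : (0 <= gap m)%R.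
  apply: Rmult_le_pos; last exact/Rlt_le/Rinv_0_lt_compat/INR_fact_lt_0.
  by have /RleP := le_st m; lra.
have cv : Un_cv (sum_f_R0 gap) (estrada t - estrada s)%R.
  apply: Un_cv_ext (CV_minus _ _ _ _ (estrada_series t) (estrada_series s)) => m.
  by rewrite -minus_sum; apply: sum_eq => j _; rewrite /gap /Rdiv; ring.
apply: Rle_trans (sum_incr gap k _ cv gap_ge0).
case: k => [|k]; first exact: Rle_refl.
rewrite /= -[X in (X <= _)%R]Rplus_0_l; apply: Rplus_le_compat_r.
exact: cond_pos_sum.
Qed.

Lemma ler_estrada : (estrada s <= estrada t)%R.
Proof.
have := estrada_gap 0; have /RleP := le_st 0.
rewrite /= /Rdiv Rinv_1 => *; lra.
Qed.

Lemma eq_estrada k : estrada s = estrada t -> power_sum s k = power_sum t k.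
Proof.
move=> st; apply/le_anti; rewrite le_st; apply/RleP.
have := estrada_gap k; rewrite st Rminus_diag => gap_le0.
have fk := INR_fact_lt_0 k.
have := Rmult_le_compat_r _ _ _ (Rlt_le _ _ fk) gap_le0.
rewrite /Rdiv Rmult_assoc Rinv_l ?Rmult_1_r ?Rmult_0_l; lra.
Qed.

End PowerSumComparison.

(** * The explicit bound and its equality case *)

Lemma estrada_star_spectrum n d : (1 < n)%nat ->
  estrada (star_spectrum n d) = (2 * cosh (sqrt (INR d)) + (INR n - 2))%R.
Proof.
move=> n_gt1; rewrite /star_spectrum /estrada /= -INRE -RsqrtE -RoppE /cosh.
have -> : List.fold_right Rplus 0%R (List.map exp (nseq (n - 2) (GRing.zero : R))) = (INR n - 2)%R.
  (* As [1 < n], the truncated [n - 2] is a true difference; each zero contributes [exp 0 = 1]. *)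
  rewrite -{2}(subnK n_gt1) plus_INR.
  elim: (n - 2)%nat => [|m IH]; first by rewrite /=; lra.
  rewrite [List.fold_right _ _ _]/= {}IH exp_0 (S_INR m); lra.
lra.
Qed.

Theorem mainTheorem9 (n : nat) (e : rel 'I_n) (lam : list R) :
  simple_graph e -> bipartite e -> has_edge e -> is_spectrum e lam ->
  (estrada lam >= 2 * cosh (sqrt (INR (max_degree e))) + (INR n - 2))%R /\
  (estrada lam = 2 * cosh (sqrt (INR (max_degree e))) + (INR n - 2) <->
     star_plus_isolated e n \/ star_plus_isolated e (max_degree e).+1)%R.
Proof.
move=> [eI eC] _ edge lamE.
have n_gt1 := has_edge_gt1 eI edge.
have [c dc] := degree_eq_max edge.
rewrite -estrada_star_spectrum //.
set S := [set j | e c j]; have cS : c \notin S by rewrite inE eI.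
have star_sub_e := star_sub eC (c := c).
have psE := power_sum_spectrum _ lamE.
have ps_star k : power_sum (star_spectrum n (max_degree e)) k =
    \tr (adj_mxR (star_rel c S) ^+ k) by rewrite power_sum_star // -dc.
have le_ps k : power_sum (star_spectrum n (max_degree e)) k <= power_sum lam k.
  by rewrite psE ps_star ler_trace_subgraph.
split; first exact/Rle_ge/ler_estrada.
split=> [eq_lam|/(star_plus_isolated_max_degree eI) [c' [S' [cS' [dS' eE]]]]].
  (* Equal Estrada indices force equal power sums at every exponent; exponent 2 identifies the graph
     with the star at [c]. *)
  have eq_e : star_rel c S =2 e.
    apply: eq_subgraph => //; first exact: star_relC.
    by rewrite -ps_star -psE; apply: eq_estrada.
  right; exists c, S; split=> //; split=> [|i j]; first by rewrite -dc.
  by rewrite -eq_e.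
(* Conversely, [e] is the star on [c'] and [S'] with [#|S'|] the maximum degree, so all power sums
   agree. *)
apply: estrada_ext => k; rewrite psE -[max_degree e]dS' -(power_sum_star _ cS') //.
by congr (\tr (_ ^+ _)); apply/matrixP => i j; rewrite !mxE eE.
Qed.
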